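(* Let $(R,\mathfrak m)$ be a two-dimensional regular local ring with maximal ideal $\mathfrak m$ and infinite residue field $R/\mathfrak m$. Let $x,y$ be a regular system of parameters for $R$ and let $I$ be an $\mathfrak m$-primary complete (i.e. integrally closed) monomial ideal with respect to $x,y$. Suppose that either (1) $\operatorname{ord}(I)\ge 3$, or (2) $\operatorname{ord}(I)=2$ and $xy\notin I$. Then there exists a finitely generated torsion-free indecomposable integrally closed $R$-module $M$ of rank $2$ with $I(M)=I$.
   Context: A monomial ideal with respect to $x,y$ is an ideal of $R$ generated by elements of the form $x^ay^b$ with $a,b\ge 0$. For an ideal $\mathfrak a$ of $R$, $\operatorname{ord}(\mathfrak a)=\max\{n\mid \mathfrak a\subset\mathfrak m^n\}$. Let $K$ be the quotient field of $R$. For a finitely generated torsion-free $R$-module $M$, put $M_K=M\otimes_RK$; the integral closure $\overline M$ of $M$ is the set of all $f\in M_K$ such that $f\in MV$ for every discrete valuation ring $V$ with $R\subset V\subset K$, where $MV$ is the $V$-submodule of $M_K$ generated by $M$. $M$ is integrally closed if $\overline M=M$. Let $F=M^{**}$ be the double $R$-dual of $M$; then $F$ is a free $R$-module which canonically contains $M$ with $F/M$ of finite length, and $I(M):=\operatorname{Fitt}_0(F/M)$ (the $0$-th Fitting ideal). If $M\subset G$ with $G$ free and $G/M$ of finite length, then $F/M\cong G/M$, so $I(M)=\operatorname{Fitt}_0(G/M)$. *)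

(* Defs.v *)
From HB Require Import structures.
From mathcomp Require Import all_boot all_order all_algebra.
From mathcomp Require Import boolp classical_sets functions cardinality.

Set Implicit Arguments.
Unset Strict Implicit.
Unset Printing Implicit Defensive.

Import Order.TTheory GRing.Theory Num.Theory.
Local Open Scope ring_scope.
Local Open Scope classical_set_scope.

(* [N] is a submodule of [W] over the subring [A] of [S].  The subring is kept
   as a parameter because the modules [MV] below are submodules over a valuation
   ring [V] inside its quotient field. *)
Definition is_submodule (S : nzRingType) (A : set S) (W : lmodType S)
    (N : set W) : Prop :=
  N 0 /\ forall a u v, A a -> N u -> N v -> N (a *: u + v).

Definition submodule_span (S : nzRingType) (A : set S) (W : lmodType S)
    (G : set W) : set W :=
  smallest (@is_submodule S A W) G.

Definition is_ideal (R : idomainType) (I : set R) : Prop :=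
  is_submodule [set: R] (I : set R^o).

Definition ideal_gen (R : idomainType) (G : set R) : set R :=
  submodule_span [set: R] (G : set R^o).

Definition ideal_pow (R : idomainType) (I : set R) (n : nat) : set R :=
  ideal_gen
    [set \prod_(i < n) f i | f in [set f : 'I_n -> R | forall i, I (f i)]].

Definition radical (R : idomainType) (I : set R) : set R :=
  [set a | exists n, I (a ^+ n)].

Definition prime_ideal (R : idomainType) (p : set R) : Prop :=
  [/\ is_ideal p, ~ p 1 & forall a b, p (a * b) -> p a \/ p b].

Definition primary_ideal (R : idomainType) (q : set R) : Prop :=
  [/\ is_ideal q, ~ q 1 &
      forall a b, q (a * b) -> q a \/ exists n, q (b ^+ n)].

Definition primary_to (R : idomainType) (m q : set R) : Prop :=
  primary_ideal q /\ radical q = m.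

Definition maximal_ideal (R : idomainType) (m : set R) : Prop :=
  [/\ is_ideal m, ~ m 1 &
      forall J, is_ideal J -> ~ J 1 -> m `<=` J -> J = m].

Definition noetherian (R : idomainType) : Prop :=
  forall I : set R, is_ideal I -> exists s : seq R, I = ideal_gen [set` s].

Definition local_ring (R : idomainType) (m : set R) : Prop :=
  [set p | @maximal_ideal R p] = [set m].

Definition prime_chain (R : idomainType) (n : nat) : Prop :=
  exists p : 'I_n.+1 -> set R,
    (forall i, prime_ideal (p i)) /\
    (forall i j : 'I_n.+1, (i < j)%N -> p i `<` p j).

Definition krull_dim (R : idomainType) (d : nat) : Prop :=
  prime_chain R d /\ forall n, prime_chain R n -> (n <= d)%N.

Definition regular_system_of_parameters (R : idomainType) (m : set R)
    (d : nat) (t : d.-tuple R) : Prop :=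
  krull_dim R d /\ m = ideal_gen [set` tval t].

(* Taking [R] to be a domain loses nothing: every regular local ring is one. *)
Definition regular_local_ring (R : idomainType) (m : set R) : Prop :=
  [/\ local_ring m, noetherian R &
      exists d (t : d.-tuple R), regular_system_of_parameters m t].

(* [R/I] as a set of cosets. *)
Definition residue_set (R : idomainType) (I : set R) : set (set R) :=
  range (fun a => [set b | I (b - a)]).

Definition monomial_ideal (R : idomainType) (x y : R) (I : set R) : Prop :=
  exists E : set (nat * nat),
    I = ideal_gen [set x ^+ e.1 * y ^+ e.2 | e in E].

Definition is_ord (R : idomainType) (m I : set R) (n : nat) : Prop :=
  I `<=` ideal_pow m n /\ forall k, I `<=` ideal_pow m k -> (k <= n)%N.

(* The value [v 0] is irrelevant. *)
Definition discrete_valuation (K : fieldType) (v : K -> int) : Prop :=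
  [/\ forall a b, a != 0 -> b != 0 -> v (a * b) = v a + v b,
      forall a b, a != 0 -> b != 0 -> a + b != 0 ->
        Num.min (v a) (v b) <= v (a + b)
    & forall k : int, exists2 a, a != 0 & v a = k].

(* The discrete valuation rings with quotient field [K].  If [V] is any discrete
   valuation ring with [R] contained in [V] and [V] in the quotient field [K]
   of [R], then [K] is the quotient field of [V]. *)
Definition dvr_of (K : fieldType) (V : set K) : Prop :=
  exists2 v : K -> int, discrete_valuation v &
    V = [set a | a = 0 \/ 0 <= v a].

Section Modules.
Variable R : idomainType.
Local Notation K := {fraction R}.
Local Notation "a %:F" := (FracField.tofrac a).

Definition finitely_generated (M : lmodType R) : Prop :=
  exists s : seq M, submodule_span [set: R] [set` s] = [set: M].

Definition torsion_free (M : lmodType R) : Prop :=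
  forall (a : R) (u : M), a *: u = 0 -> a = 0 \/ u = 0.

Definition indecomposable (M : lmodType R) : Prop :=
  [set: M] <> [set 0] /\
  forall A B : set M,
    is_submodule [set: R] A -> is_submodule [set: R] B ->
    A `&` B = [set 0] -> [set u + v | u in A & v in B] = [set: M] ->
    A = [set 0] \/ B = [set 0].

Definition semilinear_frac (M : lmodType R) (W : lmodType K) (j : M -> W) :
    Prop :=
  forall a u v, j (a *: u + v) = a%:F *: j u + j v.

(* [W], with [j], is the extension of scalars [M_K] of [M] to the quotient field
   [K], characterised by the universal property of the tensor product; it is
   unique up to a unique isomorphism compatible with [j]. *)
Definition scalar_extension (M : lmodType R) (W : lmodType K) (j : M -> W) :
    Prop :=
  semilinear_frac j /\
  forall (U : lmodType K) (f : M -> U), semilinear_frac f ->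
    exists g : {linear W -> U},
      (forall u, g (j u) = f u) /\
      forall g' : {linear W -> U}, (forall u, g' (j u) = f u) -> g' =1 g.

Definition has_rank (M : lmodType R) (n : nat) : Prop :=
  exists (W : lmodType K) (j : M -> W), scalar_extension j /\
    exists e : 'I_n -> W,
      forall w, exists! c : 'rV[K]_n, w = \sum_i c 0 i *: e i.

(* The integral closure of an [R]-submodule [N] of a [K]-vector space [W]
   spanned by [N]: the elements lying in [NV] for every discrete valuation ring
   [V] between [R] and [K]. *)
Definition integral_closure (W : lmodType K) (N : set W) : set W :=
  [set f | forall V : set K,
     dvr_of V -> (forall a : R, V a%:F) -> submodule_span V N f].

Definition integrally_closed (M : lmodType R) : Prop :=
  exists (W : lmodType K) (j : M -> W), scalar_extension j /\
    integral_closure (range j) = range j.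

(* A nonzero ideal [I] is a torsion-free module of rank 1, and the inclusion of
   [I] in [K] identifies its extension of scalars with [K]. *)
Definition complete_ideal (I : set R) : Prop :=
  let IK : set K^o := [set a%:F | a in I] in integral_closure IK = IK.

Definition linear_form (M : lmodType R) : {pred M -> R^o} :=
  [pred f : M -> R^o | `[< linear f >]].
Arguments linear_form : clear implicits.

Lemma linear_form_submod_closed (M : lmodType R) :
  submod_closed (linear_form M).
Proof.
split; first by apply/asboolP => a u v; rewrite [RHS]addr0 scaler0.
move=> a f g /asboolP fl /asboolP gl; apply/asboolP => b u v.
rewrite !fctE fl gl !scalerDr !scalerA (mulrC b a).
by rewrite -!addrA; congr (_ + _); rewrite addrCA.
Qed.

HB.instance Definition _ (M : lmodType R) :=
  GRing.isSubmodClosed.Build R (M -> R^o) (linear_form M)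
    (linear_form_submod_closed M).

Record dual_module (M : lmodType R) := Dual {
  dual_fun :> M -> R^o;
  dual_funP : dual_fun \in linear_form M }.

HB.instance Definition _ (M : lmodType R) := [isSub for @dual_fun M].
HB.instance Definition _ (M : lmodType R) := [Choice of dual_module M by <:].
HB.instance Definition _ (M : lmodType R) :=
  [SubChoice_isSubLmodule of dual_module M by <:].

Lemma bidual_subproof (M : lmodType R) (u : M) :
  (fun phi : dual_module M => phi u) \in linear_form (dual_module M).
Proof. by apply/asboolP => a phi psi. Qed.

Definition bidual_map (M : lmodType R) (u : M) : dual_module (dual_module M) :=
  Dual (bidual_subproof u).

(* [J] is the 0-th Fitting ideal of [F/N], for a submodule [N] of [F] with [F/N]
   finitely generated: given generators of [F/N], it is generated by the
   determinants of the square matrices whose rows are relations between them,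
   and it does not depend on the generators. *)
Definition is_fitting0 (F : lmodType R) (N : set F) (J : set R) : Prop :=
  exists n (g : 'I_n -> F),
    submodule_span [set: R] (range g `|` N) = [set: F] /\
    J = ideal_gen
      [set \det A | A in [set A : 'M[R]_n | forall i, N (\sum_j A i j *: g j)]].

Definition is_module_ideal (M : lmodType R) (J : set R) : Prop :=
  is_fitting0 (range (@bidual_map M)) J.

End Modules.

(* Main.v *)
From HB Require Import structures.
Require Import Defs.
From mathcomp Require Import all_boot all_order all_algebra ring.
From mathcomp Require Import boolp classical_sets functions cardinality.

(** Let [e = (x, y)] in [R ^ 2], write [u ^ v] for the minor of two vectors, and
    take for [M] the module [wedge_module] of all [u] in [R ^ 2] with [e ^ u] in
    [I].  As [x, y] is a regular sequence, [u |-> e ^ u] makes [M] an extension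
    of [I] by the free module [R e], so [M] is finitely generated.

    If [f] is in the integral closure of [M], then [e ^ f] and the products of
    the coordinates of [f] with elements of [I] are in the integral closure of
    [I], which is [I].  Since [I] contains powers of [x] and of [y], these
    coordinates are in [R], so [f] is in [M]
    ([wedge_module_integrally_closed]).

    The bidual of [M] is [R ^ 2], and [I(M)] is generated by the minors [u ^ v]
    of elements of [M].  The minors [e ^ u] give all of [I]; conversely
    [x (u ^ v)] and [y (u ^ v)] are combinations of [e ^ u] and [e ^ v] with
    coefficients in [m], and [m] can be cancelled because [I] is complete
    ([wedge_module_fitting]).

    A nontrivial decomposition of [M] would extend to [R ^ 2] and give an
    idempotent matrix [P] over [R] of rank one with [P e] in [M].  The condition
    [P e] in [M] says that a quadratic form in [x, y] whose coefficients are
    [P 1 0], [P 1 1 - P 0 0] and [- P 0 1] is in [I].  Either hypothesis on [I]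
    puts [I] in [m ^ 3 + (x ^ 2)] or in [m ^ 3 + (y ^ 2)], so that modulo [m]
    the matrix [P] is triangular with equal diagonal entries, which is
    impossible for an idempotent of rank one
    ([wedge_module_indecomposable]).

    That [x, y] is a regular sequence is deduced from the Krull dimension
    through a case of the principal ideal theorem ([pow_notin_principal]). *)

Local Open Scope ring_scope.
Local Open Scope classical_set_scope.

Set Implicit Arguments.
Unset Strict Implicit.
Unset Printing Implicit Defensive.

Import Order.TTheory GRing.Theory Num.Theory.

(** * Ideals of a local domain *)

Section Submodules.
Variables (S : nzRingType) (A : set S) (W : lmodType S).

Lemma span_is_submodule (G : set W) : is_submodule A (submodule_span A G).
Proof.
split=> [N [[]] //|a u v Aa Gu Gv N [subN GN]].
by case: (subN) => _; apply=> //; [apply: Gu | apply: Gv].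
Qed.

Lemma span_sub (G N : set W) :
  is_submodule A N -> G `<=` N -> submodule_span A G `<=` N.
Proof. exact: smallest_sub. Qed.

Lemma sub_span (G : set W) : G `<=` submodule_span A G.
Proof. exact: sub_gen_smallest. Qed.

End Submodules.

Section Ideals.
Variable R : idomainType.
Implicit Types (I J : set R) (a b : R).

Lemma ideal0 I : is_ideal I -> I 0. Proof. by case. Qed.

Lemma idealD I a b : is_ideal I -> I a -> I b -> I (a + b).
Proof. by case=> _ sI Ia Ib; rewrite -[a]mul1r; apply: (sI 1 a b). Qed.

Lemma idealM I a b : is_ideal I -> I b -> I (a * b).
Proof. by case=> I0 sI Ib; rewrite -[_ * _]addr0; apply: (sI a b 0). Qed.

Lemma idealN I a : is_ideal I -> I a -> I (- a).
Proof. by move=> iI Ia; rewrite -mulN1r; apply: idealM. Qed.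

Lemma idealB I a b : is_ideal I -> I a -> I b -> I (a - b).
Proof. by move=> iI Ia Ib; apply: idealD => //; apply: idealN. Qed.

Lemma is_idealP I :
  I 0 -> (forall a b, I a -> I b -> I (a + b)) ->
  (forall a b, I b -> I (a * b)) -> is_ideal I.
Proof. by move=> I0 ID IM; split=> // a u v _ Iu Iv; apply/ID/Iv/IM. Qed.

Lemma ideal_gen_ideal (G : set R) : is_ideal (ideal_gen G).
Proof. exact: span_is_submodule. Qed.

Lemma ideal_gen_sub (G I : set R) : is_ideal I -> G `<=` I -> ideal_gen G `<=` I.
Proof. exact: span_sub. Qed.

Lemma sub_ideal_gen (G : set R) : G `<=` ideal_gen G.
Proof. exact: (@sub_span _ [set: R] R^o). Qed.

Lemma ideal_gen_cons (a : R) (s : seq R) b :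
  ideal_gen [set` a :: s] b ->
  exists r c, b = r * a + c /\ ideal_gen [set` s] c.
Proof.
pose J := [set b | exists r c, b = r * a + c /\ ideal_gen [set` s] c].
have is_gen := ideal_gen_ideal [set` s].
apply: (ideal_gen_sub (I := J)); first apply: is_idealP.
- by exists 0, 0; rewrite mul0r addr0; split=> //; exact: (ideal0 is_gen).
- move=> _ _ [r [c [-> gc]]] [r' [c' [-> gc']]].
  by exists (r + r'), (c + c'); split; [ring | exact: (idealD is_gen)].
- move=> d _ [r [c [-> gc]]].
  by exists (d * r), (d * c); split; [ring | exact: (idealM _ is_gen)].
move=> c /=; rewrite inE => /orP[/eqP ->|sc].
  by exists 1, 0; rewrite mul1r addr0; split=> //; exact: (ideal0 is_gen).
by exists 0, c; rewrite mul0r add0r; split=> //; apply: sub_ideal_gen.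
Qed.

Lemma ideal_pair (a b c : R) :
  ideal_gen [set` [:: a; b]] c <-> exists r s, c = r * a + s * b.
Proof.
split=> [/ideal_gen_cons[r [_ [-> /ideal_gen_cons[s [d [-> gd]]]]]]|].
  have -> : d = 0.
    apply: (ideal_gen_sub (I := [set 0]) _ _ gd) => //.
    by apply: is_idealP => // [u v -> ->|u v ->]; rewrite ?addr0 ?mulr0.
  by exists r, s; rewrite addr0.
have ig := ideal_gen_ideal [set` [:: a; b]].
case=> r [s ->]; apply: (idealD ig); apply: (idealM _ ig);
  by apply: sub_ideal_gen; rewrite /= !inE eqxx ?orbT.
Qed.

Lemma proper_ideal_sub_maximal J : is_ideal J -> ~ J 1 ->
  exists p, maximal_ideal p /\ J `<=` p.
Proof.
move=> iJ J1.
(* The empty set is admitted because it is the union of the empty chain. *)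
pose P (X : set R) := X = set0 \/ [/\ is_ideal X, ~ X 1 & J `<=` X].
have [F FP totF|p [Pp maxp]] := @Zorn_bigcup R P.
  have [[X [FX [a Xa]]]|noX] := pselect (exists X, F X /\ X !=set0); last first.
    left; apply/seteqP; split=> // a [X FX Xa]; case: noX.
    by exists X; split=> //; exists a.
  have FI Y b : F Y -> Y b -> is_ideal Y.
    by move=> FY Yb; case: (FP _ FY) => [Y0|[]//]; move: Yb; rewrite Y0.
  right; split.
  - apply: is_idealP => [|b c [Y FY Yb] [Z FZ Zc]|b c [Y FY Yc]].
    + by exists X => //; apply: ideal0; apply: FI Xa.
    + case: (totF _ _ FY FZ) => sub; [exists Z | exists Y] => //.
        by apply: idealD; [apply: FI Zc | apply: sub |].
      by apply: idealD; [apply: FI Yb | | apply: sub].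
    + by exists Y => //; apply: idealM => //; apply: FI Yc.
  - move=> [Y FY Y1]; case: (FP _ FY) => [Y0|[]//].
    by move: Y1; rewrite Y0.
  - move=> b Jb; exists X => //.
    case: (FP _ FX) => [X0|[_ _]]; last exact.
    by move: Xa; rewrite X0.
have PJ : P J by right; split.
case: Pp => [p0|[ip p1 Jp]].
  exfalso; apply: (maxp J) => //; rewrite p0; split=> // /(_ 0 (ideal0 iJ)).
  exact.
exists p; split=> //; split=> // q iq q1 pq.
apply: contrapT => qp; apply: (maxp q).
  split=> // qp'; apply: qp; apply/seteqP; split=> //.
by right; split=> //; apply: subset_trans pq.
Qed.

Lemma local_unit (m : set R) a : local_ring m -> ~ m a -> a \is a GRing.unit.
Proof.
move=> lm; apply: contra_notP => aU.
pose J := [set b | exists r, b = r * a].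
have iJ : is_ideal J.
  apply: is_idealP => [|_ _ [r ->] [s ->]|b _ [r ->]].
  - by exists 0; rewrite mul0r.
  - by exists (r + s); rewrite mulrDl.
  - by exists (b * r); rewrite mulrA.
have [|p [pmax Jp]] := proper_ideal_sub_maximal iJ.
  by move=> [r r1]; apply: aU; apply/unitrPr; exists r; rewrite mulrC.
have : [set p | @maximal_ideal R p] p by [].
by rewrite lm => <-; apply: Jp; exists 1; rewrite mul1r.
Qed.

Lemma local_ring_maximal (m : set R) : local_ring m -> maximal_ideal m.
Proof. by move=> lm; have : [set m] m by []; rewrite -lm. Qed.

Lemma noetherian_acc (J : nat -> set R) : noetherian R ->
  (forall k, is_ideal (J k)) -> (forall k, J k `<=` J k.+1) ->
  exists N, forall k, J k `<=` J N.
Proof.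
move=> noeth iJ Jinc.
have Jmono k l : (k <= l)%N -> J k `<=` J l.
  move=> /subnK <-; elim: (l - k)%N => [|d IHd] //.
  exact: (subset_trans IHd (Jinc _)).
have iU : is_ideal (\bigcup_k J k).
  apply: is_idealP => [|a b [k _ Ja] [l _ Jb]|a b [k _ Jb]].
  - by exists 0%N => //; apply: ideal0.
  - exists (maxn k l) => //; apply: idealD => //.
      by apply: Jmono Ja; apply: leq_maxl.
    by apply: Jmono Jb; apply: leq_maxr.
  - by exists k => //; apply: idealM.
have [s sE] := noeth _ iU.
have [N sN] : exists N, [set` s] `<=` J N.
  have : [set` s] `<=` \bigcup_k J k by rewrite sE; apply: sub_ideal_gen.
  elim: s {sE} => [|a s IHs] sU; first by exists 0%N.
  have [k _ Ja] := sU a (mem_head a s).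
  have [b sb|N sN] := IHs; first by apply: sU; rewrite /= inE sb orbT.
  exists (maxn k N) => b; rewrite /= inE => /orP[/eqP ->|sb].
    by apply: Jmono Ja; apply: leq_maxl.
  by apply: Jmono (sN b sb); apply: leq_maxr.
exists N => k a Jka; apply: (ideal_gen_sub (iJ N) sN).
by rewrite -sE; exists k.
Qed.

End Ideals.

(** * A system of parameters of length two is a regular sequence *)

Section Dimension.
Variables (R : idomainType) (m : set R).
Hypotheses (local_m : local_ring m) (noeth : noetherian R).

Let m_ideal : is_ideal m. Proof. by case: (local_ring_maximal local_m). Qed.
Let m1 : ~ m 1. Proof. by case: (local_ring_maximal local_m). Qed.

Lemma one_sub_unit a : m a -> 1 - a \is a GRing.unit.
Proof.
move=> ma; apply: (local_unit local_m) => m1a; apply: m1.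
by rewrite -[1](subrK a); apply: idealD.
Qed.

(** Nakayama's lemma.  The generators of [p] are discarded one at a time: the
    first one left, [h], satisfies [(1 - x * r) * h] in [(z)] plus the ideal of
    the others, and [1 - x * r] is a unit. *)
Lemma nakayama_principal (p : set R) (x z : R) : is_ideal p -> m x ->
  (forall a, p a -> exists b c, a = b * z + x * c /\ p c) ->
  forall a, p a -> exists b, a = b * z.
Proof.
move=> ip mx pzx.
have [s sE] := noeth ip.
have sp : [set` s] `<=` p by rewrite sE; apply: sub_ideal_gen.
have : forall a, p a -> exists b c, a = b * z + c /\ ideal_gen [set` s] c.
  by move=> a pa; exists 0, a; rewrite mul0r add0r -sE.
elim: s {sE} sp => [|h s IHs] sp ps a pa.
  have [b [c [-> gc]]] := ps _ pa; exists b.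
  have -> : c = 0; last by rewrite addr0.
  apply: (ideal_gen_sub (I := [set 0]) _ _ gc) => //.
  by apply: is_idealP => // [u v -> ->|u v ->]; rewrite ?addr0 ?mulr0.
have gs := ideal_gen_ideal [set` s].
have [b [c [hE pc]]] := pzx h (sp _ (mem_head h s)).
have [b' [c' [cE /ideal_gen_cons[r [d [c'E gd]]]]]] := ps _ pc.
have /unitrPr[v v1] : 1 - x * r \is a GRing.unit.
  by apply: one_sub_unit; rewrite mulrC; apply: idealM.
have {}hE : h = (v * (b + x * b')) * z + (v * x) * d.
  rewrite -[LHS]mul1r -v1 (_ : (1 - x * r) * v * h = v * (h - x * (r * h)));
    last by ring.
  have -> : x * (r * h) = h - b * z - x * b' * z - x * d.
    by rewrite [in RHS]hE cE c'E; ring.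
  by ring.
apply: IHs pa => [e se|e pe]; first by apply: sp; rewrite /= inE se orbT.
have [t [_ [-> /ideal_gen_cons[q [f [-> gf]]]]]] := ps _ pe.
exists (t + q * (v * (b + x * b'))), (q * (v * x) * d + f); split.
  by rewrite [in LHS]hE; ring.
by apply: (idealD gs) => //; apply: (idealM _ gs).
Qed.

Variables x y : R.
Hypothesis mE : forall a, m a <-> exists b c, a = b * x + c * y.

Let mx : m x. Proof. by apply/mE; exists 1, 0; ring. Qed.
Let my : m y. Proof. by apply/mE; exists 0, 1; ring. Qed.

(** Modulo [x] the maximal ideal is generated by [y], so a factor [y] can be
    extracted until a unit is left. *)
Lemma unit_pow_mod N a :
  (exists b c, a = b * y ^+ N + c * x) \/
  exists j, (j < N)%N /\
    exists u c, u \is a GRing.unit /\ a = u * y ^+ j + c * x.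
Proof.
elim: N => [|N [[b [c ->]]|[j [jN aE]]]].
- by left; exists a, 0; ring.
- have [/mE[r [s ->]]|mb] := pselect (m b).
    by left; exists s, (r * y ^+ N + c); rewrite exprS; ring.
  by right; exists N; split=> //; exists b, c; split=> //; apply: (local_unit local_m).
- by right; exists j; split=> //; apply: leqW.
Qed.

Lemma prime_sub_m (p : set R) : prime_ideal p -> p `<=` m.
Proof.
move=> [ip p1 _] a pa; apply: contrapT => /(local_unit local_m) /unitrPr[b ab].
by apply: p1; rewrite -ab mulrC; apply: idealM.
Qed.

Lemma prime_ideal_exp (p : set R) a n : prime_ideal p -> p (a ^+ n) -> p a.
Proof.
move=> [_ p1 pM]; elim: n => [|n IHn]; first by rewrite expr0.
by rewrite exprS => /pM[|].
Qed.

Lemma intermediate_prime : krull_dim R 2 ->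
  exists p, [/\ prime_ideal p, exists2 z, p z & z != 0 & exists2 a, m a & ~ p a].
Proof.
move=> [[p [pP plt]] _].
pose i1 : 'I_3 := inord 1.
have i1E : i1 = 1%N :> nat by rewrite /i1 inordK.
exists (p i1); split; first exact: pP.
- have [|_ /existsNP[z /not_implyP[pz np0]]] := plt ord0 i1; first by rewrite i1E.
  exists z => //; apply/eqP => z0; apply: np0; rewrite z0.
  by case: (pP ord0) => ip _ _; apply: ideal0.
- have [|_ /existsNP[a /not_implyP[pa np1]]] := plt i1 ord_max; first by rewrite i1E.
  by exists a => //; apply: (prime_sub_m (pP ord_max)).
Qed.

(** A case of Krull's principal ideal theorem.  If [x] divided a power of [y], then every ideal of [R / x] would be generated
    by a power of [y], and a nonzero prime [p] strictly inside [m] would not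
    contain [x].  By Nakayama's lemma such a [p] would be generated by a single
    element [z], some power of which is divisible by [x].  As [x] is not
    divisible by the prime [z], this makes [x] a unit. *)
Lemma pow_notin_principal n d : krull_dim R 2 -> y ^+ n <> d * x.
Proof.
move=> /intermediate_prime[p [pP [w pw w0] [a ma npa]]] ynE.
have [ip p1 pM] := pP.
have npx : ~ p x.
  move=> px; apply: npa; move/mE: ma => [b [c ->]].
  apply: idealD => //; apply: idealM => //.
  by apply: (prime_ideal_exp (n := n) pP); rewrite ynE; apply: idealM.
(* [y ^+ k] is the generator of the image of [p] in [R / x]. *)
have : exists k, `[< exists z c, p z /\ y ^+ k = z + c * x >].
  by exists n; apply/asboolP; exists 0, d; split; [apply: ideal0 | rewrite add0r].
move=> /ex_minnP[k /asboolP[z [c [pz ykE]]] kmin].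
have pgen : forall b, p b -> exists r s, b = r * z + x * s /\ p s.
  move=> b pb.
  suff [r [s bE]] : exists r s, b = r * z + x * s.
    exists r, s; split=> //; have : p (x * s).
      by rewrite (_ : x * s = b - r * z); [apply: idealB => //; apply: idealM
        | rewrite bE; ring].
    by case/pM.
  have [[r [s ->]]|[j [jk [u [s [uU bE]]]]]] := unit_pow_mod k b.
    by exists r, (r * c + s); rewrite ykE; ring.
  have: (k <= j)%N.
    apply: kmin; apply/asboolP; exists (u^-1 * b), (- (u^-1 * s)).
    by split; [apply: idealM | rewrite bE mulrDr mulKr //; ring].
  by rewrite leqNgt jk.
have zgen := nakayama_principal ip mx pgen.
have z0 : z != 0.
  by apply: contra_neq w0 => z0; have [b ->] := zgen _ pw; rewrite z0 mulr0.
have [t ztE] : exists t, z ^+ n = t * x.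
  have /mE[b [e zE]] : m z by apply: (prime_sub_m pP).
  have [f ->] : exists f, z ^+ n = (e * y) ^+ n + f * x.
    rewrite zE addrC; elim: n {ynE} => [|l [f IHl]].
      by exists 0; rewrite !expr0; ring.
    by exists (f * (e * y) + f * b * x + b * (e * y) ^+ l); rewrite !exprS IHl; ring.
  by exists (e ^+ n * d + f); rewrite exprMn ynE; ring.
have xn : forall l r, z ^+ l = r * x -> exists s, 1 = s * x.
  elim=> [|l IHl] r rE; first by exists r; rewrite -rE expr0.
  have : p (r * x) by rewrite -rE exprS mulrC; apply: idealM.
  case/pM => [/zgen[s sE]|//]; apply: (IHl s).
  by apply: (mulfI z0); rewrite -exprS rE sE; ring.
have [s s1] := xn _ _ ztE.
by apply: m1; rewrite s1; apply: idealM.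
Qed.

(** The ideals [(x : y ^+ k)] stabilise, at [k = N] say.  Either [a] is in
    [(y ^+ N, x)], and [y * a] in [(x)] gives [a] in [(x)] by the choice of [N];
    or [a] is a unit times a power of [y] modulo [x], which would put a power
    of [y] in [(x)]. *)
Lemma parameters_regular a : krull_dim R 2 ->
  (exists b, y * a = b * x) -> exists b, a = b * x.
Proof.
move=> dim2 [b yaE].
pose J k := [set a | exists b, y ^+ k * a = b * x].
have [k||N JN] := noetherian_acc (J := J) noeth.
- apply: is_idealP => [|u v [r uE] [s vE]|u v [s vE]].
  + by exists 0; ring.
  + by exists (r + s); rewrite mulrDr uE vE; ring.
  + by exists (u * s); rewrite mulrCA vE mulrA.
- by move=> k u [r uE]; exists (y * r); rewrite exprS -mulrA uE mulrA.
have [[c [d aE]]|[j [_ [u [c [uU aE]]]]]] := unit_pow_mod N a.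
  have [|r rE] := JN N.+1 c.
    exists (b - y * d); rewrite exprS.
    rewrite (_ : y * y ^+ N * c = y * a - y * d * x); last by rewrite aE; ring.
    by rewrite yaE; ring.
  by exists (r + d); rewrite aE [c * _]mulrC rE; ring.
exfalso; apply: (@pow_notin_principal j.+1 (u^-1 * (b - y * c)) dim2).
rewrite -[LHS](mulKr uU) -mulrA; congr (_ * _).
by rewrite exprS mulrBl -yaE aE; ring.
Qed.

End Dimension.

(** * Relations between two coprime elements *)

Section RegularPair.
Variables (R : idomainType) (m : set R) (x y : R).
Hypothesis mE : forall a, m a <-> exists b c, a = b * x + c * y.
Hypothesis x0 : x != 0.
Hypothesis xy_reg : forall a, (exists b, y * a = b * x) -> exists b, a = b * x.

Lemma regular_pow n k a b :
  y ^+ k * a = b * x ^+ n -> exists c, a = c * x ^+ n.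
Proof.
have reg1 a' b' : y ^+ k * a' = b' * x -> exists c, a' = c * x.
  elim: k a' b' => [|k IHk] a' b' yaE; first by exists b'; rewrite -yaE mul1r.
  have [|c] := @xy_reg (y ^+ k * a'); first by exists b'; rewrite mulrA -exprS.
  exact: IHk.
elim: n a b => [|n IHn] a b yaE; first by exists a; rewrite expr0 mulr1.
have [c aE] : exists c, a = c * x.
  by apply: (reg1 a (b * x ^+ n)); rewrite yaE exprS; ring.
have [d cE] : exists d, c = d * x ^+ n.
  by apply: (IHn c b); apply: (mulIf x0); rewrite -mulrA -aE yaE exprS; ring.
by exists d; rewrite aE cE exprS; ring.
Qed.

Lemma koszul_relation a b : x * b = y * a -> exists c, a = c * x /\ b = c * y.
Proof.
move=> xbE; have [|c aE] := @xy_reg a; first by exists b; rewrite -xbE mulrC.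
by exists c; split=> //; apply: (mulfI x0); rewrite xbE aE; ring.
Qed.

(** The Koszul relation is applied three times to peel off the coefficients;
    this is the quadratic part of the quasi-regularity of [x, y]. *)
Lemma quadric_relation a b c : a * x ^+ 2 + b * (x * y) + c * y ^+ 2 = 0 ->
  [/\ m a, m b & m c].
Proof.
move=> E0.
have [|d [gE abE]] := @koszul_relation (- (c * y)) (a * x + b * y).
  by apply/eqP; rewrite -subr_eq0 -[X in _ == X]E0; apply/eqP; ring.
have [|e [cE dE]] := @koszul_relation (- c) d.
  by rewrite mulrC -gE; ring.
have [|f [bE aE]] := @koszul_relation (e * y - b) a.
  by rewrite (_ : x * a = (a * x + b * y) - b * y);
    [rewrite abE dE; ring | ring].
split; apply/mE.
- by exists 0, f; rewrite aE; ring.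
- by exists (- f), e; rewrite -[b](subKr (e * y)) bE; ring.
- by exists (- e), 0; rewrite -[c]opprK cE; ring.
Qed.

End RegularPair.

(** * The module of vectors whose wedge with [(x, y)] lies in [I] *)

Section WedgeModule.
Variables (R : idomainType) (x y : R) (I : set R).
Hypothesis iI : is_ideal I.

Local Notation F := (R^o * R^o)%type.
Local Notation K := {fraction R}.
Local Notation KF := (K^o * K^o)%type.
Local Notation "a %:F" := (FracField.tofrac a).

Definition wedge (u : F) : R := x * u.2 - y * u.1.

Lemma wedge_linear a u v : wedge (a *: u + v) = a * wedge u + wedge v.
Proof. by rewrite /wedge /= /GRing.scale /=; ring. Qed.

(** The proof that [I] is an ideal is an argument so that the submodule
    structure can be attached to the predicate. *)
Definition wedge_pred of is_ideal I : {pred F} :=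
  [pred u | `[< I (wedge u) >]].

Lemma wedge_pred_closed : submod_closed (wedge_pred iI).
Proof.
split=> [|a u v /asboolP Iu /asboolP Iv]; apply/asboolP.
  by rewrite /wedge /= !mulr0 subr0; apply: ideal0.
by rewrite wedge_linear; apply: idealD => //; apply: idealM.
Qed.

HB.instance Definition _ :=
  GRing.isSubmodClosed.Build R F (wedge_pred iI) wedge_pred_closed.

Record wedge_module := WedgeModule {
  wedge_vec :> F;
  wedge_vecP : wedge_vec \in wedge_pred iI }.

HB.instance Definition _ := [isSub for wedge_vec].
HB.instance Definition _ := [Choice of wedge_module by <:].
HB.instance Definition _ := [SubChoice_isSubLmodule of wedge_module by <:].

Local Notation M := wedge_module.

Lemma wedgeP (u : M) : I (wedge u).
Proof. by apply/asboolP; apply: wedge_vecP. Qed.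

Lemma wedge_lift (u : F) : I (wedge u) -> exists w : M, w = u :> F.
Proof. by move=> /asboolP Iu; exists (WedgeModule Iu). Qed.

Lemma wedge_vecZ a (u : M) : (a *: u : M) = a *: (u : F) :> F.
Proof. by []. Qed.

Lemma wedge_vec_inj (u v : M) : u.1 = v.1 -> u.2 = v.2 -> u = v.
Proof.
by case: u v => [[u1 u2] uP] [[v1 v2] vP] /= uv1 uv2; apply: val_inj; rewrite /= uv1 uv2.
Qed.

Lemma torsion_free_wedge : torsion_free M.
Proof.
move=> a u au0; have [->|a0] := eqVneq a 0; [by left | right].
have au : a *: (u : F) = 0 by rewrite -wedge_vecZ au0.
by apply: wedge_vec_inj; apply: (mulfI a0); rewrite mulr0;
  [apply: (congr1 fst au) | apply: (congr1 snd au)].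
Qed.

End WedgeModule.

Section FinitelyGenerated.
Variables (R : idomainType) (x y : R) (I : set R).
Hypotheses (iI : is_ideal I) (x0 : x != 0).
Hypothesis xy_reg : forall a, (exists b, y * a = b * x) -> exists b, a = b * x.

Local Notation M := (wedge_module x y iI).

Lemma xy_vector_subproof : (x, y) \in wedge_pred x y iI.
Proof. by apply/asboolP; rewrite /wedge /= mulrC subrr; apply: ideal0. Qed.

Definition xy_vector : M := WedgeModule xy_vector_subproof.

(** The wedge with [(x, y)] presents the module as an extension of [I] by the
    free module on [(x, y)]. *)
Lemma wedge_module_fg :
  noetherian R -> (forall h, I h -> exists b c, h = b * x + c * y) ->
  finitely_generated M.
Proof.
move=> /(_ I iI)[s sE] Im.
have [t tP] : exists t : seq M, forall h, h \in s -> exists2 u, u \in t & wedge x y u = h.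
  have : [set` s] `<=` I by rewrite sE; apply: sub_ideal_gen.
  elim: s {sE} => [|h s IHs] sI; first by exists [::].
  have [g gs|t tP] := IHs; first by apply: sI; rewrite /= inE gs orbT.
  have Ih : I h by apply: sI; rewrite /= inE eqxx.
  have [b [c hE]] := Im _ Ih.
  have [|u uE] := @wedge_lift _ x y I iI (- c, b).
    by rewrite /wedge /= (_ : _ - _ = h) // hE; ring.
  exists (u :: t) => g; rewrite inE => /orP[/eqP ->|/tP[w wt wE]].
    by exists u; rewrite ?inE ?eqxx // uE /wedge hE /=; ring.
  by exists w; rewrite // inE wt orbT.
exists (xy_vector :: t); apply/seteqP; split=> // w _.
set S := submodule_span _ _.
have genS : [set` xy_vector :: t] `<=` S by apply: sub_gen_smallest.
have [S0 SP] : is_submodule [set: R] S by apply: span_is_submodule.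
have sub : I `<=` [set h | exists2 u, S u & wedge x y u = h].
  rewrite [X in X `<=` _]sE; apply: ideal_gen_sub.
    split; first by exists 0; rewrite // /wedge /= !mulr0 subr0.
    move=> a _ _ _ [u Su <-] [v Sv <-]; exists (a *: u + v); first exact: SP.
    exact: wedge_linear.
  move=> h /tP[u ut uE]; exists u => //; apply: genS.
  by rewrite /= inE ut orbT.
have [u Su uE] := sub _ (wedgeP w).
have [|c [w1 w2]] := koszul_relation x0 xy_reg (a := (w : _ * _).1 - (u : _ * _).1)
  (b := (w : _ * _).2 - (u : _ * _).2).
  apply/eqP; rewrite -subr_eq0 (_ : _ - _ = wedge x y w - wedge x y u).
    by rewrite uE subrr.
  by rewrite /wedge; ring.
have -> : w = c *: xy_vector + u.
  by apply: wedge_vec_inj; rewrite /= /GRing.scale /= -?w1 -?w2 subrK.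
by apply: SP => //; apply: genS; rewrite /= inE eqxx.
Qed.

End FinitelyGenerated.

(** * Extension of scalars *)

Section ScalarExtension.
Variables (R : idomainType) (x y : R) (I : set R).
Hypothesis iI : is_ideal I.

Local Notation M := (wedge_module x y iI).
Local Notation K := {fraction R}.
Local Notation "a %:F" := (FracField.tofrac a).

Lemma tofrac_inj : injective (@FracField.tofrac R).
Proof. by move=> a b /eqP; rewrite tofrac_eq => /eqP. Qed.

Lemma ideal_vec h a b : I h -> exists u : M, u = (a * h, b * h) :> R^o * R^o.
Proof.
move=> Ih; apply: wedge_lift.
rewrite /wedge /= (_ : _ - _ = (x * b - y * a) * h); first exact: idealM.
by ring.
Qed.

Definition frac_vec (u : M) : K^o * K^o :=
  (FracField.tofrac ((u : R^o * R^o).1 : R), FracField.tofrac ((u : R^o * R^o).2 : R)).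

Lemma frac_vec_semilinear : semilinear_frac frac_vec.
Proof.
by move=> a u v; rewrite /frac_vec /= /GRing.scale /= !tofracD !tofracM.
Qed.

(** A semilinear map is determined by its values at the vectors [(h, 0)] and
    [(0, h)] of the module, which become a basis over the fraction field. *)
Lemma frac_vec_extension h : I h -> h != 0 -> scalar_extension frac_vec.
Proof.
move=> Ih h0; split; first exact: frac_vec_semilinear.
move=> U f fl.
have [u1 u1E] := ideal_vec 1 0 Ih; have [u2 u2E] := ideal_vec 0 1 Ih.
have hK : h%:F != 0 by rewrite tofrac_eq0.
have f0 : f 0 = 0.
  have := fl 1 0 0; rewrite scaler0 addr0 tofrac1 scale1r => f00.
  by apply: (addrI (f 0)); rewrite addr0 -f00.
have fZ a u : f (a *: u) = a%:F *: f u.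
  by rewrite -[a *: u]addr0 fl f0 addr0.
pose g (w : K^o * K^o) : U := (w.1 / h%:F) *: f u1 + (w.2 / h%:F) *: f u2.
have gl : linear g.
  move=> a u v; rewrite /g (_ : (a *: u + v).1 = a * u.1 + v.1) //.
  rewrite (_ : (a *: u + v).2 = a * u.2 + v.2) //.
  by rewrite !mulrDl !scalerDl scalerDr !scalerA !mulrA addrACA.
pose gL : {linear (K^o * K^o)%type -> U} := HB.pack g (GRing.isLinear.Build _ _ _ _ g gl).
have decomp (u : M) : h *: u =
      ((u : R^o * R^o).1 : R) *: u1 + ((u : R^o * R^o).2 : R) *: u2.
  by apply: wedge_vec_inj; rewrite /= u1E u2E /= /GRing.scale /=; ring.
exists gL; split=> [u|g' g'P w] /=.
  apply: (scalerI hK); rewrite -fZ decomp fl fZ /g /= scalerDr !scalerA.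
  by rewrite ![h%:F * _]mulrC !divfK.
rewrite /g -!g'P -!linearZ -linearD; congr (g' _).
rewrite /frac_vec u1E u2E /= !mul1r !mul0r tofrac0 /GRing.scale /=.
case: w => w1 w2 /=; congr (_, _); rewrite /= scaler0 ?addr0 ?add0r.
  by rewrite /GRing.scale /= divfK.
by rewrite /GRing.scale /= divfK.
Qed.

Lemma wedge_module_rank h : I h -> h != 0 -> has_rank M 2.
Proof.
move=> Ih h0; exists (K^o * K^o)%type, frac_vec; split.
  exact: (frac_vec_extension Ih h0).
exists (fun i => if i == 0 then (1, 0) else (0, 1)) => -[w1 w2].
have sumE (c : 'rV[K]_2) : \sum_i c 0 i *:
    ((if i == 0 then (1, 0) else (0, 1)) : K^o * K^o) = (c 0 0, c 0 1).
  rewrite !big_ord_recl big_ord0 addr0 /=; congr (_, _); rewrite /= /GRing.scale /=.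
    by rewrite mulr1 mulr0 addr0.
  by rewrite mulr0 mulr1 add0r; congr (c _ _); apply: val_inj.
exists (\row_i if i == 0 then w1 else w2); split.
  by rewrite sumE !mxE.
move=> c; rewrite sumE => -[-> ->]; apply/rowP => i; rewrite mxE.
case: eqP => [->//|i0]; congr (c _ _); apply: val_inj => /=.
by case: i i0 => [[|[|//]]] ? // i0; case: i0; apply: val_inj.
Qed.

End ScalarExtension.

(** * Integral closedness *)

Section DVR.
Variables (K : fieldType) (V : set K).
Hypothesis dvrV : dvr_of V.

Lemma dvr0 : V 0. Proof. by case: dvrV => v _ ->; left. Qed.

Lemma dvrD a b : V a -> V b -> V (a + b).
Proof.
case: dvrV => v [_ vD _] ->.
have [->|a0] := eqVneq a 0; first by rewrite add0r.
have [->|b0] := eqVneq b 0; first by rewrite addr0.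
move=> [a0'|va]; first by rewrite a0' eqxx in a0.
move=> [b0'|vb]; first by rewrite b0' eqxx in b0.
have [->|ab0] := eqVneq (a + b) 0; [by left|right].
by apply: le_trans (vD _ _ a0 b0 ab0); rewrite le_min va vb.
Qed.

Lemma dvrM a b : V a -> V b -> V (a * b).
Proof.
case: dvrV => v [vM _ _] ->.
have [->|a0] := eqVneq a 0; first by rewrite mul0r; left.
have [->|b0] := eqVneq b 0; first by rewrite mulr0; left.
move=> [a0'|va]; first by rewrite a0' eqxx in a0.
move=> [b0'|vb]; first by rewrite b0' eqxx in b0.
by right; rewrite vM // addr_ge0.
Qed.

Lemma dvr_total a b : a != 0 -> b != 0 -> V (a / b) \/ V (b / a).
Proof.
case: dvrV => v [vM _ _] -> a0 b0.
have v1 : v 1 = 0.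
  have := vM 1 1 (oner_neq0 _) (oner_neq0 _); rewrite mulr1 => v1.
  by apply: (addrI (v 1)); rewrite addr0 -v1.
have vab : v (b / a) = - v (a / b).
  apply/eqP; rewrite -addr_eq0 -vM ?mulf_neq0 ?invr_neq0 //.
  by rewrite mulrA divfK // divff // v1.
case: (leP 0 (v (a / b))) => vab0; [by left; right|right; right].
by rewrite vab oppr_ge0 ltW.
Qed.

End DVR.

Section Completeness.
Variables (R : idomainType) (I : set R).
Local Notation K := {fraction R}.
Local Notation "a %:F" := (FracField.tofrac a).

Let IV (V : set K) : set K^o :=
  submodule_span V ([set a%:F | a in I] : set K^o).

Lemma ideal_extensionM (V : set K) (c f : K) : V c -> IV V f -> IV V (c * f).
Proof.
have [S0 SP] := span_is_submodule V ([set a%:F | a in I] : set K^o).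
by move=> Vc Sf; rewrite -[_ * _]addr0; apply: (SP c f 0).
Qed.

Lemma ideal_extensionD (V : set K) (f g : K) : V 1 -> IV V f -> IV V g -> IV V (f + g).
Proof.
have [S0 SP] := span_is_submodule V ([set a%:F | a in I] : set K^o).
by move=> V1 Sf Sg; rewrite -[f]mul1r; apply: (SP 1 f g).
Qed.

Lemma ideal_extension_tofrac (V : set K) a : I a -> IV V a%:F.
Proof. by move=> Ia; apply: sub_gen_smallest; exists a. Qed.

Lemma complete_frac (f : K) : complete_ideal I ->
  (forall V : set K, dvr_of V -> (forall a : R, V a%:F) -> IV V f) ->
  exists2 a, I a & a%:F = f.
Proof. by move=> cI fV; have : [set a%:F | a in I] f by rewrite -cI. Qed.

Lemma complete_ideal_mem (a : R) : complete_ideal I ->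
  (forall V : set K, dvr_of V -> (forall a : R, V a%:F) -> IV V a%:F) -> I a.
Proof. by move=> cI /(complete_frac cI)[b Ib /tofrac_inj <-]. Qed.

Lemma ideal_extension_ratio (V : set K) (a b c : R) :
  (forall a : R, V a%:F) -> V (b%:F / c%:F) -> c != 0 -> I (a * c) -> IV V (a * b)%:F.
Proof.
move=> VR Vbc c0 Iac.
have -> : (a * b)%:F = (b%:F / c%:F) * (a * c)%:F.
  by rewrite !tofracM [a%:F * c%:F]mulrC mulrA divfK ?tofrac_eq0 // mulrC.
by apply: ideal_extensionM => //; apply: ideal_extension_tofrac.
Qed.

(** In a discrete valuation ring, [x] divides [y] or [y] divides [x]. *)
Lemma complete_mixed_term (x y : R) : complete_ideal I ->
  x != 0 -> y != 0 -> I (x ^+ 2) -> I (y ^+ 2) -> I (x * y).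
Proof.
move=> cI x0 y0 Ix Iy; apply: complete_ideal_mem => // V dV VR.
have [||xy|yx] := @dvr_total _ V dV x%:F y%:F; rewrite ?tofrac_eq0 //.
  by rewrite mulrC; apply: (ideal_extension_ratio (c := y)).
by apply: (ideal_extension_ratio (c := x)).
Qed.

(** A discrete valuation ring makes the ideal [(x, y)] principal, generated by
    [x] or by [y]; dividing by this generator shows that [d] is in the
    extension of [I]. *)
Lemma complete_cancel (x y d : R) : complete_ideal I -> x != 0 -> y != 0 ->
  (forall z, z = x \/ z = y -> exists b c b' c' h h',
     [/\ I h, I h' & z * d = (b * x + c * y) * h + (b' * x + c' * y) * h']) ->
  I d.
Proof.
move=> cI x0 y0 zd; apply: complete_ideal_mem => // V dV VR.
have V1 : V 1 by rewrite -(tofrac1 R).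
have [z [z0 zxy Vx Vy]] : exists z : R,
    [/\ z != 0, z = x \/ z = y, V (x%:F / z%:F) & V (y%:F / z%:F)].
  have xx (z : R) : z != 0 -> z%:F / z%:F = 1 by move=> z0; rewrite divff ?tofrac_eq0.
  have [||xy|yx] := @dvr_total _ V dV x%:F y%:F; rewrite ?tofrac_eq0 //.
    by exists y; split=> //; [right | rewrite xx].
  by exists x; split=> //; [left | rewrite xx].
have [b [c [b' [c' [h [h' [Ih Ih' zdE]]]]]]] := zd z zxy.
have zK : z%:F != 0 :> K by rewrite tofrac_eq0.
have Vm (r s : R) : V (r%:F * (x%:F / z%:F) + s%:F * (y%:F / z%:F)).
  by apply: (dvrD dV); apply: (dvrM dV).
have -> : d%:F = (b%:F * (x%:F / z%:F) + c%:F * (y%:F / z%:F)) * h%:F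
    + (b'%:F * (x%:F / z%:F) + c'%:F * (y%:F / z%:F)) * h'%:F.
  have factor (L : fieldType) (t r s p q : L) : t != 0 ->
      (r * p + s * q) = t * (r * (p / t) + s * (q / t)) by move=> t0; field.
  apply: (mulfI zK); rewrite -tofracM zdE !(tofracD, tofracM).
  by rewrite mulrDr ![z%:F * (_ * _)]mulrA -!factor.
by apply: ideal_extensionD => //; apply: ideal_extensionM => //;
  apply: ideal_extension_tofrac.
Qed.

End Completeness.

Section WedgeModuleClosed.
Variables (R : idomainType) (x y : R) (I : set R) (n : nat).
Hypotheses (iI : is_ideal I) (cI : complete_ideal I).
Hypothesis x0 : x != 0.
Hypothesis xy_reg : forall a, (exists b, y * a = b * x) -> exists b, a = b * x.
Hypotheses (Ixn : I (x ^+ n)) (Iyn : I (y ^+ n)).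

Local Notation M := (wedge_module x y iI).
Local Notation K := {fraction R}.
Local Notation KF := (K^o * K^o)%type.
Local Notation "a %:F" := (FracField.tofrac a).

(** A fraction whose denominator can be taken to be a power of [x] as well as
    a power of [y] has no denominator. *)
Lemma frac_regular (f : K) :
  (exists a, a%:F = f * (x ^+ n)%:F) -> (exists b, b%:F = f * (y ^+ n)%:F) ->
  exists c, f = c%:F.
Proof.
move=> [a aE] [b bE].
have [|c acE] := @regular_pow _ x y x0 xy_reg n n a b.
  by apply: tofrac_inj; rewrite !tofracM aE bE; ring.
exists c; have xK : (x ^+ n)%:F != 0 :> K by rewrite tofrac_eq0 expf_neq0.
by apply: (mulIf xK); rewrite -aE acE tofracM.
Qed.

(** The wedge with [(x, y)] of an element of the integral closure belongs to
    the integral closure of [I], that is, to [I]; and its coordinates multiply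
    [I] into the integral closure of [I], so they have no denominators. *)
Lemma wedge_module_integrally_closed : integrally_closed M.
Proof.
exists KF, (@frac_vec R x y I iI); split.
  exact: (frac_vec_extension x y iI Ixn (expf_neq0 _ x0)).
apply/seteqP; split=> [f fM|f fM V dV VR]; last exact: sub_gen_smallest.
pose N (V : set K) : set KF := [set f : KF | [/\ V f.1, V f.2 &
  submodule_span V ([set a%:F | a in I] : set K^o) (x%:F * f.2 - y%:F * f.1)]].
have fN V : dvr_of V -> (forall a : R, V a%:F) -> N V f.
  move=> dV VR; apply: (span_sub _ _ (fM V dV VR)) => [|_ [u _ <-]].
    have [S0 SP] := span_is_submodule V ([set a%:F | a in I] : set K^o).
    split; first by split; rewrite /= ?mulr0 ?subr0 //; apply: (dvr0 dV).
    move=> a u v Va [Vu1 Vu2 Su] [Vv1 Vv2 Sv].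
    split; [exact: (dvrD dV (dvrM dV Va Vu1) Vv1)
           | exact: (dvrD dV (dvrM dV Va Vu2) Vv2) | ].
    have := SP a _ _ Va Su Sv; congr (submodule_span _ _ _).
    by rewrite /= /GRing.scale /=; ring.
  split; [exact: VR | exact: VR | apply: sub_gen_smallest].
  exists (wedge x y u); first exact: wedgeP.
  by rewrite /wedge /= !(tofracB, tofracM).
have coordI (g : K) h : I h ->
    (forall V : set K, dvr_of V -> (forall a : R, V a%:F) -> V g) ->
    exists a, a%:F = g * h%:F.
  move=> Ih gV; have [|a _ aE] := complete_frac (f := g * h%:F) cI; last by exists a.
  by move=> V dV VR; apply: ideal_extensionM; [exact: gV | exact: ideal_extension_tofrac].
have f1V V : dvr_of V -> (forall a : R, V a%:F) -> V f.1 by move=> dV /(fN V dV)[].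
have f2V V : dvr_of V -> (forall a : R, V a%:F) -> V f.2 by move=> dV /(fN V dV)[].
have [a aE] : exists a, f.1 = a%:F by apply: frac_regular; apply: coordI.
have [b bE] : exists b, f.2 = b%:F by apply: frac_regular; apply: coordI.
have [|h Ih hE] := complete_frac (f := x%:F * f.2 - y%:F * f.1) cI.
  by move=> V dV VR; case: (fN V dV VR).
have [|u uE] := @wedge_lift _ x y I iI (a, b).
  rewrite /wedge /= (_ : _ - _ = h) //; apply: tofrac_inj.
  by rewrite hE aE bE tofracB !tofracM.
exists u => //; rewrite /frac_vec uE /= -aE -bE.
by case: (f).
Qed.

End WedgeModuleClosed.

(** * The Fitting ideal *)

Section Fitting.
Variables (R : idomainType) (x y : R) (I : set R) (n : nat).
Hypotheses (iI : is_ideal I) (cI : complete_ideal I).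
Hypotheses (x0 : x != 0) (y0 : y != 0).
Hypothesis xy_reg : forall a, (exists b, y * a = b * x) -> exists b, a = b * x.
Hypotheses (Ixn : I (x ^+ n)) (Iyn : I (y ^+ n)).
Hypothesis I_quadric : forall h, I h ->
  exists a b c, h = a * x ^+ 2 + b * (x * y) + c * y ^+ 2.

Local Notation M := (wedge_module x y iI).
Local Notation F := (R^o * R^o)%type.
Local Notation fst2 u := ((u : F).1 : R).
Local Notation snd2 u := ((u : F).2 : R).

(** A relation [x * g - y * f = q] with [q] in [(x, y) ^ 2] can be corrected, by
    elements of [(x, y)], to a Koszul relation. *)
Lemma wedge_coord (u : M) :
  (exists b c, fst2 u = b * x + c * y) /\ (exists b c, snd2 u = b * x + c * y).
Proof.
have [a [b [c uE]]] := I_quadric (wedgeP u).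
have [|k [u1 u2]] := koszul_relation x0 xy_reg (a := fst2 u + c * y)
  (b := snd2 u - a * x - b * y).
  apply/eqP; rewrite -subr_eq0; apply/eqP.
  rewrite (_ : _ - _ = wedge x y u - (a * x ^+ 2 + b * (x * y) + c * y ^+ 2)).
    by rewrite uE subrr.
  by rewrite /wedge; ring.
split; first by exists k, (- c); rewrite mulNr -u1 addrK.
by exists a, (b + k); rewrite mulrDl addrA -[k * y]u2; ring.
Qed.

(** If [d] is the minor, then [x * d] and [y * d] are combinations of
    [wedge x y u] and [wedge x y v] with coefficients in [(x, y)], namely
    coordinates of [u] and [v]. *)
Lemma wedge_module_minor (u v : M) : I (fst2 u * snd2 v - snd2 u * fst2 v).
Proof.
have [[b1 [c1 u1]] [b2 [c2 u2]]] := wedge_coord u.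
have [[b3 [c3 v1]] [b4 [c4 v2]]] := wedge_coord v.
have Iu := wedgeP u; have Iv := wedgeP v.
apply: (complete_cancel cI x0 y0) => z [->|->].
  exists b1, c1, (- b3), (- c3), (wedge x y v), (wedge x y u); split=> //.
  by rewrite !mulNr -opprD -u1 -v1 /wedge; ring.
exists b2, c2, (- b4), (- c4), (wedge x y v), (wedge x y u); split=> //.
by rewrite !mulNr -opprD -u2 -v2 /wedge; ring.
Qed.

Lemma dual_lin (phi : dual_module M) a u v :
  phi (a *: u + v) = a * phi u + phi v.
Proof. by have /asboolP := dual_funP phi; apply. Qed.

Lemma dual_linD (phi : dual_module M) u v : phi (u + v) = phi u + phi v.
Proof. by rewrite -[u]scale1r dual_lin mul1r scale1r. Qed.

Lemma dual_lin0 (phi : dual_module M) : phi 0 = 0.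
Proof. by apply: (addrI (phi 0)); rewrite -dual_linD !addr0. Qed.

Lemma dual_linZ (phi : dual_module M) a u : phi (a *: u) = a * phi u.
Proof. by rewrite -[a *: u]addr0 dual_lin dual_lin0 addr0. Qed.

(** On a coordinate vector [e_i], the value [phi (x ^+ n e_i)] is divisible by
    [x ^+ n], because its product with [y ^+ n] is [x ^+ n * phi (y ^+ n e_i)];
    the quotient is the coefficient of [phi] at [e_i]. *)
Lemma dual_coord (phi : dual_module M) : exists a b,
  forall u : M, phi u = a * fst2 u + b * snd2 u.
Proof.
have [p1 p1E] := ideal_vec x y iI 1 0 Ixn.
have [p2 p2E] := ideal_vec x y iI 0 1 Ixn.
have [q1 q1E] := ideal_vec x y iI 1 0 Iyn.
have [q2 q2E] := ideal_vec x y iI 0 1 Iyn.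
have xn0 : x ^+ n != 0 by rewrite expf_neq0.
have div (p q : M) : y ^+ n *: p = x ^+ n *: q -> exists a, phi p = a * x ^+ n.
  move=> pq; apply: (@regular_pow _ x y x0 xy_reg n n _ (phi q)).
  by rewrite -dual_linZ pq dual_linZ mulrC.
have [|a aE] := div p1 q1.
  by apply: wedge_vec_inj; rewrite /= p1E q1E /= /GRing.scale /=; ring.
have [|b bE] := div p2 q2.
  by apply: wedge_vec_inj; rewrite /= p2E q2E /= /GRing.scale /=; ring.
exists a, b => u; apply: (mulfI xn0).
rewrite -dual_linZ (_ : _ *: u = fst2 u *: p1 + snd2 u *: p2).
  by rewrite dual_linD !dual_linZ aE bE; ring.
by apply: wedge_vec_inj; rewrite /= p1E p2E /= /GRing.scale /=; ring.
Qed.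

Lemma coord_inj a b a' b' :
  (forall u : M, a * fst2 u + b * snd2 u = a' * fst2 u + b' * snd2 u) ->
  a = a' /\ b = b'.
Proof.
have [p1 p1E] := ideal_vec x y iI 1 0 Ixn.
have [p2 p2E] := ideal_vec x y iI 0 1 Ixn.
move=> E; have := E p1; have := E p2; rewrite p1E p2E /= !mul0r !mulr0 !mul1r.
by rewrite !addr0 !add0r; split; apply: (mulIf (expf_neq0 n x0)).
Qed.

Lemma coord_fst_linear : (fun u : M => fst2 u) \in @linear_form R M.
Proof. by apply/asboolP => a u v. Qed.

Lemma coord_snd_linear : (fun u : M => snd2 u) \in @linear_form R M.
Proof. by apply/asboolP => a u v. Qed.

Definition coord_fst : dual_module M := Dual coord_fst_linear.
Definition coord_snd : dual_module M := Dual coord_snd_linear.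

Definition dual_coords (phi : dual_module M) : R * R :=
  xget (0, 0) [set ab | forall u : M, phi u = ab.1 * fst2 u + ab.2 * snd2 u].

Lemma dual_coordsE (phi : dual_module M) u :
  phi u = (dual_coords phi).1 * fst2 u + (dual_coords phi).2 * snd2 u.
Proof.
rewrite /dual_coords; case: xgetP => [ab _ phiE|noab]; first exact: phiE.
by have [a [b phiE]] := dual_coord phi; case: (noab (a, b)).
Qed.

Lemma dual_coords_eq (phi : dual_module M) a b :
  (forall u : M, phi u = a * fst2 u + b * snd2 u) -> dual_coords phi = (a, b).
Proof.
move=> phiE; have [|c1 c2] := @coord_inj (dual_coords phi).1 (dual_coords phi).2 a b.
  by move=> u; rewrite -dual_coordsE.
by rewrite [LHS]surjective_pairing c1 c2.
Qed.

Lemma dual_coords_lin a (phi psi : dual_module M) :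
  dual_coords (a *: phi + psi) =
  (a * (dual_coords phi).1 + (dual_coords psi).1,
   a * (dual_coords phi).2 + (dual_coords psi).2).
Proof.
apply: dual_coords_eq => u.
have -> : (a *: phi + psi) u = a * phi u + psi u by [].
by rewrite (dual_coordsE phi) (dual_coordsE psi); ring.
Qed.

Lemma bidual_fst_linear :
  (fun phi => (dual_coords phi).1 : R^o) \in @linear_form R (dual_module M).
Proof. by apply/asboolP => a phi psi; rewrite dual_coords_lin. Qed.

Lemma bidual_snd_linear :
  (fun phi => (dual_coords phi).2 : R^o) \in @linear_form R (dual_module M).
Proof. by apply/asboolP => a phi psi; rewrite dual_coords_lin. Qed.

(** The bidual is free on the evaluations at the two coordinate vectors of the
    ambient plane. *)
Definition bidual_basis (i : 'I_2) : dual_module (dual_module M) :=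
  if i == 0 then Dual bidual_fst_linear else Dual bidual_snd_linear.

Lemma bidual_sum (c : 'I_2 -> R) (phi : dual_module M) :
  (\sum_j c j *: bidual_basis j) phi =
  c 0 * (dual_coords phi).1 + c 1 * (dual_coords phi).2.
Proof.
rewrite !big_ord_recl big_ord0 addr0.
by rewrite (_ : lift ord0 ord0 = 1) //; apply: val_inj.
Qed.

Lemma bidual_mapE (u : M) (phi : dual_module M) :
  bidual_map u phi = fst2 u * (dual_coords phi).1 + snd2 u * (dual_coords phi).2.
Proof. by rewrite /= dual_coordsE; ring. Qed.

Lemma bidual_eq (f g : dual_module (dual_module M)) :
  (forall phi, f phi = g phi) -> f = g.
Proof. by move=> fg; apply: val_inj; apply: funext. Qed.

Lemma bidual_rangeP (c : 'I_2 -> R) :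
  range (@bidual_map R M) (\sum_j c j *: bidual_basis j) <->
  exists u : M, fst2 u = c 0 /\ snd2 u = c 1.
Proof.
split=> [[u _ uE]|[u [u1 u2]]]; last first.
  by exists u => //; apply: bidual_eq => phi; rewrite bidual_sum bidual_mapE u1 u2.
have fstE : dual_coords coord_fst = (1, 0).
  by apply: dual_coords_eq => v; rewrite mul1r mul0r addr0.
have sndE : dual_coords coord_snd = (0, 1).
  by apply: dual_coords_eq => v; rewrite mul1r mul0r add0r.
exists u; have := bidual_sum c coord_fst; have := bidual_sum c coord_snd.
rewrite -uE fstE sndE /= !mulr0 !mulr1 addr0 add0r.
by [].
Qed.

Lemma bidual_expand (f : dual_module (dual_module M)) :
  f = \sum_j (if j == 0 then f coord_fst : R else f coord_snd : R) *: bidual_basis j.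
Proof.
apply: bidual_eq => phi; rewrite bidual_sum /=.
have fl a u v : f (a *: u + v) = a * f u + f v.
  by have /asboolP := dual_funP f; apply.
have f0 : f 0 = 0.
  have := fl 1 0 0; rewrite scale1r addr0 mul1r => f00.
  by apply: (addrI (f 0)); rewrite addr0 -f00.
rewrite {1}(_ : phi = (dual_coords phi).1 *: coord_fst +
    ((dual_coords phi).2 *: coord_snd + 0)).
  by rewrite !fl f0 addr0 mulrC [X in _ + X]mulrC.
apply: val_inj; apply: funext => u.
by rewrite /= dual_coordsE addr0.
Qed.

(** In the basis of the bidual, relations modulo [M] are pairs of vectors of
    [M], and their determinants are minors.  An [h] in [I] is the minor of
    [(x, y)] with a vector whose wedge is [h]. *)
Lemma wedge_module_fitting : is_module_ideal M I.
Proof.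
exists 2%N, bidual_basis; split.
  apply/seteqP; split=> // f _; rewrite (bidual_expand f).
  have [S0 SP] := span_is_submodule [set: R]
    (range bidual_basis `|` range (@bidual_map R M)).
  have genS i : submodule_span [set: R]
      (range bidual_basis `|` range (@bidual_map R M)) (bidual_basis i).
    by apply: sub_gen_smallest; left; exists i.
  rewrite !big_ord_recl big_ord0.
  exact: (SP _ _ _ Logic.I (genS _) (SP _ _ _ Logic.I (genS _) S0)).
have detE (A : 'M[R]_2) : \det A = A 0 0 * A 1 1 - A 0 1 * A 1 0.
  rewrite (expand_det_row _ 0) !big_ord_recl big_ord0 addr0 /cofactor !det_mx11 !mxE /=.
  rewrite (_ : lift ord0 ord0 = 1); last exact: val_inj.
  rewrite (_ : lift 1 0 = 0); last exact: val_inj.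
  by rewrite expr0 expr1; ring.
apply/seteqP; split=> [h Ih|]; last first.
  apply: ideal_gen_sub => // _ [A Arel <-].
  have /bidual_rangeP[u [u1 u2]] := Arel 0.
  have /bidual_rangeP[v [v1 v2]] := Arel 1.
  by rewrite detE -u1 -u2 -v1 -v2; apply: wedge_module_minor.
have [a [b [c hE]]] := I_quadric Ih.
have [|u uE] := @wedge_lift _ x y I iI (- (c * y), a * x + b * y).
  by rewrite /wedge /= (_ : _ - _ = h) // hE; ring.
apply: sub_ideal_gen; exists (\matrix_(i, j) if i == 0 then (if j == 0 then x else y)
  else (if j == 0 then fst2 u else snd2 u)).
  move=> i /=.
  have -> : \sum_j (\matrix_(i0, j0) (if i0 == 0 then if j0 == 0 then x else y
      else if j0 == 0 then fst2 u else snd2 u)) i j *: bidual_basis j =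
    \sum_j (if i == 0 then if j == 0 then x else y
      else if j == 0 then fst2 u else snd2 u) *: bidual_basis j.
    by apply: eq_bigr => j _; rewrite mxE.
  apply/bidual_rangeP; case: eqP => _; first by exists (xy_vector x y iI).
  by exists u.
by rewrite detE !mxE /= uE /= hE; ring.
Qed.

End Fitting.

(** * Indecomposability *)

Section Decomposition.
Variables (R : idomainType) (x y : R) (I : set R) (n : nat).
Hypotheses (iI : is_ideal I) (x0 : x != 0).
Hypothesis xy_reg : forall a, (exists b, y * a = b * x) -> exists b, a = b * x.
Hypotheses (Ixn : I (x ^+ n)) (Iyn : I (y ^+ n)).

Local Notation M := (wedge_module x y iI).
Local Notation F := (R^o * R^o)%type.
Local Notation fst2 u := ((u : F).1 : R).
Local Notation snd2 u := ((u : F).2 : R).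

Section Submodule.
Variable A : set M.
Hypothesis subA : is_submodule [set: R] A.

Lemma submodD u v : A u -> A v -> A (u + v).
Proof. by case: subA => _ SP Au Av; rewrite -[u]scale1r; apply: SP. Qed.

Lemma submodZ a u : A u -> A (a *: u).
Proof. by case: subA => S0 SP Au; rewrite -[a *: u]addr0; apply: SP. Qed.

Lemma submodB u v : A u -> A v -> A (u - v).
Proof. by move=> Au Av; rewrite -scaleN1r; apply/submodD/submodZ. Qed.

Lemma submod_nontrivial : A <> [set 0] -> exists2 a, A a & a != 0.
Proof.
move=> A0; apply: contrapT => noa; apply: A0; apply/seteqP; split=> [a Aa|_ ->].
  by apply: contrapT => /eqP a0; apply: noa; exists a.
by case: subA.
Qed.

End Submodule.

(** By Cramer's rule, the minor of [a] and [a'] multiplies [b] into [A], hence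
    into [A `&` B]. *)
Lemma rank_one_summand (A B : set M) (b a a' : M) :
  is_submodule [set: R] A -> is_submodule [set: R] B -> A `&` B = [set 0] ->
  B b -> b != 0 -> A a -> A a' -> fst2 a * snd2 a' = snd2 a * fst2 a'.
Proof.
move=> subA subB AB0 Bb b0 Aa Aa'.
pose d : R := fst2 a * snd2 a' - snd2 a * fst2 a'.
have cramer : d *: b = (fst2 b * snd2 a' - snd2 b * fst2 a') *: a +
    (fst2 a * snd2 b - snd2 a * fst2 b) *: a'.
  by apply: wedge_vec_inj; rewrite /d /= /GRing.scale /=; ring.
have : (A `&` B) (d *: b).
  split; last exact: (submodZ subB).
  by rewrite cramer; apply: (submodD subA); apply: (submodZ subA).
rewrite AB0 => /torsion_free_wedge[d0|/eqP]; last by rewrite (negPf b0).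
by apply/eqP; rewrite -subr_eq0; apply/eqP.
Qed.

(** A decomposition of the module extends to the ambient free module [R ^ 2]:
    its projection [P], a matrix over the fraction field, maps [x ^+ n] times
    and [y ^+ n] times each coordinate vector into [R ^ 2], hence has
    coefficients in [R]. Here [P] has rows [(p, q)] and [(r, s)]; both [P] and
    [1 - P] have rank one, and [P] maps [(x, y)] into the module. *)
Lemma decomposition_idempotent (A B : set M) :
  is_submodule [set: R] A -> is_submodule [set: R] B ->
  A `&` B = [set 0] -> [set u + v | u in A & v in B] = [set: M] ->
  A <> [set 0] -> B <> [set 0] ->
  exists p q r s : R, [/\ p * s = q * r, p + s = 1 &
    I (r * x ^+ 2 + (s - p) * (x * y) - q * y ^+ 2)].
Proof.
move=> subA subB AB0 AB An0 Bn0.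
have [a0 Aa0 a0n] := submod_nontrivial subA An0.
have [b0 Bb0 b0n] := submod_nontrivial subB Bn0.
have xn0 : x ^+ n != 0 by rewrite expf_neq0.
have split_AB (u : M) : exists a b, [/\ A a, B b & u = a + b].
  have : [set: M] u by [].
  by rewrite -AB => -[a Aa [b Bb <-]]; exists a, b.
have uniq_A (a a' b b' : M) : A a -> A a' -> B b -> B b' ->
    a + b = a' + b' -> a = a'.
  move=> Aa Aa' Bb Bb' E; apply/eqP; rewrite -subr_eq0; apply/eqP.
  have : (A `&` B) (a - a').
    split; first exact: (submodB subA).
    rewrite (_ : a - a' = b' - b); first exact: (submodB subB).
    by apply/eqP; rewrite subr_eq addrAC eq_sym subr_eq E addrC.
  by rewrite AB0.
have proj (u v : M) : y ^+ n *: u = x ^+ n *: v ->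
    exists a b c d, [/\ A a, B b, u = a + b & a = (c * x ^+ n, d * x ^+ n) :> F].
  move=> uv; have [a [b [Aa Bb uE]]] := split_AB u.
  have [a' [b' [Aa' Bb' vE]]] := split_AB v.
  have aa' : y ^+ n *: a = x ^+ n *: a'.
    apply: (uniq_A _ _ (y ^+ n *: b) (x ^+ n *: b')).
    - exact: (submodZ subA).
    - exact: (submodZ subA).
    - exact: (submodZ subB).
    - exact: (submodZ subB).
    - by rewrite -!scalerDr -uE -vE.
  have [c cE] : exists c, fst2 a = c * x ^+ n.
    apply: (@regular_pow _ x y x0 xy_reg n n _ (fst2 a')).
    rewrite mulrC [RHS]mulrC.
    have := congr1 (fun w : M => fst2 w) aa'.
    by rewrite /= /GRing.scale /= mulrC => ->.
  have [d dE] : exists d, snd2 a = d * x ^+ n.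
    apply: (@regular_pow _ x y x0 xy_reg n n _ (snd2 a')).
    rewrite mulrC [RHS]mulrC.
    have := congr1 (fun w : M => snd2 w) aa'.
    by rewrite /= /GRing.scale /= mulrC => ->.
  by exists a, b, c, d; split=> //; rewrite [LHS]surjective_pairing cE dE.
have [u1 u1E] := ideal_vec x y iI 1 0 Ixn; have [v1 v1E] := ideal_vec x y iI 1 0 Iyn.
have [u2 u2E] := ideal_vec x y iI 0 1 Ixn; have [v2 v2E] := ideal_vec x y iI 0 1 Iyn.
have [|a1 [b1 [p [r [Aa1 Bb1 uab1 a1E]]]]] := proj u1 v1.
  by apply: wedge_vec_inj; rewrite /= u1E v1E /= /GRing.scale /=; ring.
have [|a2 [b2 [q [s [Aa2 Bb2 uab2 a2E]]]]] := proj u2 v2.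
  by apply: wedge_vec_inj; rewrite /= u2E v2E /= /GRing.scale /=; ring.
have bE (u a b : M) : u = a + b -> fst2 b = fst2 u - fst2 a /\ snd2 b = snd2 u - snd2 a.
  by move=> ->; rewrite /=; split; rewrite addrC addKr.
have [b11 b12] := bE _ _ _ uab1; have [b21 b22] := bE _ _ _ uab2.
have det0 : p * s = q * r.
  have := rank_one_summand subA subB AB0 Bb0 b0n Aa1 Aa2; rewrite a1E a2E /= => E.
  by apply: (mulfI (mulf_neq0 xn0 xn0)); move/eqP: E; rewrite -subr_eq0 => /eqP E;
    apply/eqP; rewrite -subr_eq0 -[X in _ == X]E; apply/eqP; ring.
exists p, q, r, s; split=> //.
  have BA0 : B `&` A = [set 0] by rewrite setIC.
  have := rank_one_summand subB subA BA0 Aa0 a0n Bb1 Bb2.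
  rewrite b11 b12 b21 b22 a1E a2E u1E u2E /= => E.
  apply/eqP; rewrite eq_sym -subr_eq0; apply/eqP.
  apply: (mulfI (mulf_neq0 xn0 xn0)); rewrite mulr0.
  move/eqP: E; rewrite -subr_eq0 => /eqP E; rewrite -[RHS]E.
  rewrite [RHS](_ : _ = x ^+ n * x ^+ n * (1 - (p + s) + (p * s - q * r))); last by ring.
  by rewrite det0 subrr addr0.
have [ae [be [Aae Bbe eE]]] := split_AB (xy_vector x y iI).
have aeE : x ^+ n *: ae = x *: a1 + y *: a2.
  apply: (uniq_A _ _ (x ^+ n *: be) (x *: b1 + y *: b2)).
  - exact: (submodZ subA).
  - by apply: (submodD subA); apply: (submodZ subA).
  - exact: (submodZ subB).
  - by apply: (submodD subB); apply: (submodZ subB).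
  - rewrite -scalerDr -eE addrACA -!scalerDr -uab1 -uab2.
    by apply: wedge_vec_inj; rewrite /= u1E u2E /= /GRing.scale /=; ring.
have ae1 : fst2 ae = p * x + q * y.
  apply: (mulfI xn0); have := congr1 (fun w : M => fst2 w) aeE.
  by rewrite /= a1E a2E /= /GRing.scale /= => ->; ring.
have ae2 : snd2 ae = r * x + s * y.
  apply: (mulfI xn0); have := congr1 (fun w : M => snd2 w) aeE.
  by rewrite /= a1E a2E /= /GRing.scale /= => ->; ring.
have := wedgeP ae; rewrite /wedge ae1 ae2.
by rewrite (_ : x * _ - _ = r * x ^+ 2 + (s - p) * (x * y) - q * y ^+ 2) //; ring.
Qed.

(** An idempotent as above has [1 = (s - p) ^ 2 + 4 r q], so it cannot exist
    when every quadratic form in [I] has its mixed coefficient and the product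
    of the two others in a proper ideal. *)
Lemma wedge_module_indecomposable (m : set R) : is_ideal m -> ~ m 1 ->
  (forall r t q, I (r * x ^+ 2 + t * (x * y) - q * y ^+ 2) -> m t /\ m (r * q)) ->
  indecomposable M.
Proof.
move=> im m1 Im; split.
  move=> M0; have [u uE] := ideal_vec x y iI 1 0 Ixn.
  have : [set: M] u by [].
  rewrite M0 => u0; move/eqP: (expf_neq0 n x0); apply.
  by have := congr1 (fun w : M => fst2 w) u0; rewrite uE /= mul1r.
move=> A B subA subB AB0 AB; apply: contrapT => /not_orP[An0 Bn0].
have [p [q [r [s [det0 tr1 /Im[msp mrq]]]]]] :=
  decomposition_idempotent subA subB AB0 AB An0 Bn0.
apply: m1; rewrite (_ : 1 = (s - p) * (s - p) + 4 * (r * q)).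
  by apply: idealD => //; apply: idealM.
transitivity ((p + s) * (p + s)); first by rewrite tr1 mulr1.
by rewrite [r * q]mulrC -det0; ring.
Qed.

End Decomposition.

(** * Quadratic forms in a monomial ideal *)

Section Quadrics.
Variables (R : idomainType) (m : set R).
Hypothesis m_ideal : is_ideal m.
Implicit Types (x y : R) (A B C I : set R).

Definition quadrics x y A B C : set R :=
  [set h | exists a b c,
    [/\ A a, B b, C c & h = a * x ^+ 2 + b * (x * y) + c * y ^+ 2]].

Lemma setT_ideal : is_ideal [set: R]. Proof. by []. Qed.

Lemma quadrics_ideal x y A B C : is_ideal A -> is_ideal B -> is_ideal C ->
  is_ideal (quadrics x y A B C).
Proof.
move=> iA iB iC; apply: is_idealP.
- by exists 0, 0, 0; split; [exact: ideal0 .. | ring].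
- move=> _ _ [a [b [c [Aa Bb Cc ->]]]] [a' [b' [c' [Aa' Bb' Cc' ->]]]].
  by exists (a + a'), (b + b'), (c + c'); split; [exact: idealD .. | ring].
- move=> d _ [a [b [c [Aa Bb Cc ->]]]].
  by exists (d * a), (d * b), (d * c); split; [exact: idealM .. | ring].
Qed.

Lemma quadrics_swap x y A B C : quadrics x y A B C `<=` quadrics y x C B A.
Proof.
by move=> _ [a [b [c [Aa Bb Cc ->]]]]; exists c, b, a; split=> //; ring.
Qed.

(** The product of two elements of [m] is a quadratic form, and a third factor
    in [m] multiplies its coefficients. *)
Lemma ideal_pow_quadrics x y n :
  (forall a, m a <-> exists b c, a = b * x + c * y) -> (3 <= n)%N ->
  ideal_pow m n `<=` quadrics x y setT m m.
Proof.
case: n => [|[|[|n]]] // mE _; apply: ideal_gen_sub.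
  exact: (quadrics_ideal x y setT_ideal m_ideal m_ideal).
move=> _ [f fm <-]; rewrite !big_ord_recl.
set f0 := f _; set f1 := f _; set g := f _ * _.
have /mE[b0 [c0 ->]] : m f0 by apply: fm.
have /mE[b1 [c1 ->]] : m f1 by apply: fm.
have mg : m g by rewrite /g mulrC; apply: idealM.
exists (b0 * b1 * g), ((b0 * c1 + c0 * b1) * g), (c0 * c1 * g).
by split; [ | apply: idealM.. | ring].
Qed.

(** The only monomials that are not such quadratic forms are [1], [x], [y],
    [x * y] and [y ^+ 2]; each of them divides [x * y] or is [y ^+ 2]. *)
Lemma monomial_quadrics x y I a b : m x -> m y -> is_ideal I ->
  ~ I (x * y) -> ~ I (y ^+ 2) -> I (x ^+ a * y ^+ b) ->
  quadrics x y setT m m (x ^+ a * y ^+ b).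
Proof.
move=> mx my iI nxy nyy.
have m0 := ideal0 m_ideal.
case: a => [|[|a]] Iab; last first.
- by exists (x ^+ a * y ^+ b), 0, 0; split=> //; rewrite !exprS; ring.
- case: b Iab => [|[|b]] Iab.
  + by case: nxy; rewrite mulrC (_ : x = x ^+ 1 * y ^+ 0); [exact: idealM | ring].
  + by case: nxy; rewrite (_ : x * y = x ^+ 1 * y ^+ 1) //; ring.
  + exists 0, 0, (y ^+ b * x); split=> //; first exact: idealM.
    by rewrite !exprS; ring.
case: b Iab => [|[|[|b]]] Iab.
- by case: nxy; rewrite -[x * y]mulr1 (_ : 1 = x ^+ 0 * y ^+ 0); [exact: idealM | ring].
- by case: nxy; rewrite (_ : y = x ^+ 0 * y ^+ 1); [exact: idealM | ring].
- by case: nyy; rewrite (_ : y ^+ 2 = x ^+ 0 * y ^+ 2) //; ring.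
exists 0, 0, (y ^+ b * y); split=> //; first exact: idealM.
by rewrite !exprS; ring.
Qed.

(** Two expressions of the same element as a quadratic form in [x] and [y] have
    congruent coefficients modulo [m]. *)
Lemma quadrics_coef x y I :
  (forall a, m a <-> exists b c, a = b * x + c * y) -> x != 0 ->
  (forall a, (exists b, y * a = b * x) -> exists b, a = b * x) ->
  I `<=` quadrics x y setT m m \/ I `<=` quadrics x y m m setT ->
  forall r t q, I (r * x ^+ 2 + t * (x * y) - q * y ^+ 2) -> m t /\ m (r * q).
Proof.
move=> mE x0 xy_reg sub r t q Ih.
have coef a b c :
    r * x ^+ 2 + t * (x * y) - q * y ^+ 2 = a * x ^+ 2 + b * (x * y) + c * y ^+ 2 ->
    [/\ m (r - a), m (t - b) & m (- q - c)].
  move=> E; apply: (quadric_relation mE x0 xy_reg).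
  apply/eqP; rewrite -[X in _ == X](subrr (a * x ^+ 2 + b * (x * y) + c * y ^+ 2)).
  by rewrite -{1}E; apply/eqP; ring.
case: sub => /(_ _ Ih)[a [b [c [ma mb mc /coef[mra mtb mqc]]]]];
  (split; first by rewrite -[t](subrK b); apply: idealD).
  rewrite (_ : r * q = - r * ((- q - c) + c)); last by ring.
  by apply: idealM => //; apply: idealD.
rewrite (_ : r * q = q * ((r - a) + a)); last by ring.
by apply: idealM => //; apply: idealD.
Qed.

End Quadrics.

Theorem theorem1p3 (R : idomainType) (m : set R) (x y : R) (I : set R) (n : nat)
  (regR : regular_local_ring m) (dimR : krull_dim R 2)
  (residue_infinite : infinite_set (residue_set m))
  (xy_params : regular_system_of_parameters m [tuple x; y])
  (I_primary : primary_to m I)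
  (I_complete : complete_ideal I)
  (I_monomial : monomial_ideal x y I)
  (I_ord : is_ord m I n)
  (I_case : (3 <= n)%N \/ (n = 2%N /\ ~ I (x * y))) :
  exists M : lmodType R,
    [/\ finitely_generated M, torsion_free M, indecomposable M &
    [/\ integrally_closed M, has_rank M 2 & is_module_ideal M I]].
Proof.
have [local_m noeth _] := regR.
have [m_ideal m1 _] := local_ring_maximal local_m.
have mE a : m a <-> exists b c, a = b * x + c * y.
  by rewrite (proj2 xy_params); apply: ideal_pair.
have mE' a : m a <-> exists b c, a = b * y + c * x.
  by rewrite mE; split=> -[b [c ->]]; exists c, b; rewrite addrC.
have mx : m x by apply/mE; exists 1, 0; ring.
have my : m y by apply/mE; exists 0, 1; ring.
have xy_reg a := parameters_regular local_m noeth mE (a := a) dimR.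
have yx_reg a := parameters_regular local_m noeth mE' (a := a) dimR.
have x0 : x != 0.
  apply/eqP => x0; have [|b b1] := yx_reg 1; first by exists 0; rewrite x0; ring.
  by apply: m1; rewrite b1; apply: idealM.
have y0 : y != 0.
  apply/eqP => y0; have [|b b1] := xy_reg 1; first by exists 0; rewrite y0; ring.
  by apply: m1; rewrite b1; apply: idealM.
have [[iI _ _] radI] := I_primary.
have [N [Ixn Iyn]] : exists N, I (x ^+ N) /\ I (y ^+ N).
  have [k Ik] : radical I x by rewrite radI.
  have [l Il] : radical I y by rewrite radI.
  by exists (k + l)%N; rewrite [in x ^+ _]addnC !exprD; split; apply: idealM.
have I_quad : I `<=` quadrics x y setT m m \/ I `<=` quadrics x y m m setT.
  case: I_case => [n3|[_ nxy]].
    by left; apply: subset_trans (proj1 I_ord) (ideal_pow_quadrics m_ideal mE n3).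
  have [E IE] := I_monomial.
  have gen e : E e -> I (x ^+ e.1 * y ^+ e.2).
    by move=> Ee; rewrite IE; apply: sub_ideal_gen; exists e.
  have [nyy|Iyy] := pselect (~ I (y ^+ 2)).
    left; rewrite [X in X `<=` _]IE; apply: ideal_gen_sub.
      exact: (quadrics_ideal x y (setT_ideal R) m_ideal m_ideal).
    by move=> _ [e /gen Ie <-]; apply: monomial_quadrics Ie.
  have nxx : ~ I (x ^+ 2).
    by move=> Ixx; apply: nxy; apply: complete_mixed_term => //; apply: contrapT.
  right; rewrite [X in X `<=` _]IE; apply: ideal_gen_sub.
    exact: (quadrics_ideal x y m_ideal m_ideal (setT_ideal R)).
  move=> _ [e /gen + <-]; rewrite mulrC => Ie; apply: quadrics_swap.
  by apply: monomial_quadrics Ie => //; rewrite mulrC.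
have Im h : I h -> exists a b c, h = a * x ^+ 2 + b * (x * y) + c * y ^+ 2.
  by case: I_quad => sub /sub[a [b [c [_ _ _ ->]]]]; exists a, b, c.
exists (wedge_module x y iI); split.
- apply: wedge_module_fg => // h /Im[a [b [c ->]]].
  by exists (a * x + b * y), (c * y); ring.
- exact: torsion_free_wedge.
- apply: (wedge_module_indecomposable iI x0 xy_reg Ixn Iyn m_ideal m1).
  exact: quadrics_coef.
split.
- exact: (wedge_module_integrally_closed iI I_complete x0 xy_reg Ixn Iyn).
- exact: (wedge_module_rank x y iI Ixn (expf_neq0 _ x0)).
- exact: (wedge_module_fitting iI I_complete x0 y0 xy_reg Ixn Iyn Im).
Qed.
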